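(* Let $\mathscr{A}=\varprojlim\mathscr{A}_\alpha$ be a unital locally $C^*$-algebra, $\mathcal{M}$ a Hilbert $\mathscr{A}$-module, and $\mathcal{H},\mathcal{K}$ locally Hilbert spaces with index set $\Delta$. Let $[\varphi]=(\varphi_{ij})_{i,j=1}^n$ be a continuous completely $n$-positive map from $\mathscr{A}$ to $\mathscr{L}(\mathcal{H})$ and let $[\Phi]=(\Phi_{ij})_{i,j=1}^n$, $\Phi_{ij}:\mathcal{M}\to\mathscr{L}(\mathcal{H},\mathcal{K})$, be a $[\varphi]$-completely positive $n\times n$ matrix. Let $$(\pi,H,K,S_1,\dots,S_n,W_1,\dots,W_n)\quad\text{and}\quad(\pi',H',K',S_1',\dots,S_n',W_1',\dots,W_n')$$ be minimal Stinespring representations of $([\varphi],[\Phi])$, where $\pi$ and $\pi'$ are associated with the continuous $*$-homomorphisms $\pi^\varphi:\mathscr{A}\to\mathscr{L}(H)$ and $(\pi^\varphi)':\mathscr{A}\to\mathscr{L}(H')$, respectively. Then there exist unitary operators $U_1:H\to H'$ and $U_2:K\to K'$ such that (1) $U_1S_i=S_i'$ for all $i\in\{1,\dots,n\}$, and $U_1\pi^\varphi(a)=(\pi^\varphi)'(a)U_1$ for all $a\in\mathscr{A}$; (2) $U_2W_i=W_i'$ for all $i\in\{1,\dots,n\}$, and $U_2\pi(x)=\pi'(x)U_1$ for all $x\in\mathcal{M}$.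
   Context: Locally $C^*$-algebras: a locally $C^*$-algebra $\mathscr{A}$ is a complete Hausdorff topological $*$-algebra whose topology is given by an upward directed family of $C^*$-seminorms; $\mathscr{A}=\varprojlim\mathscr{A}_\alpha$ is an inverse limit of $C^*$-algebras. The directed set $S(\mathscr{A})$ of all continuous $C^*$-seminorms $\|\cdot\|_\alpha$ on $\mathscr{A}$ is assumed to coincide with the index set $\Delta$ of the locally Hilbert spaces. Hilbert modules: a Hilbert $\mathscr{A}$-module $\mathcal{M}$ is a right $\mathscr{A}$-module with an $\mathscr{A}$-valued inner product, $\mathbb{C}$- and $\mathscr{A}$-linear in the second variable, with $\langle y,x\rangle=\langle x,y\rangle^*$ (and positive definite, as usual), complete for the seminorms $\|x\|_\alpha=\|\langle x,x\rangle\|_\alpha^{1/2}$, $\alpha\in\Delta$. Locally Hilbert spaces: for an upward directed set $\Delta$ and Hilbert spaces $\mathcal{H}_\alpha$ with $\mathcal{H}_\alpha$ a closed subspace of $\mathcal{H}_\beta$ for $\alpha\le\beta$, $\mathcal{H}=\varinjlim\mathcal{H}_\alpha=\bigcup_\alpha\mathcal{H}_\alpha$ with the inductive limit locally convex topology is a locally Hilbert space. All locally Hilbert spaces here have index set $\Delta$. $\mathscr{L}(\mathcal{H},\mathcal{K})$ is the set of linear $T:\mathcal{H}\to\mathcal{K}$ with $T(\mathcal{H}_\alpha)\subseteq\mathcal{K}_\alpha$, $T_\alpha:=T|_{\mathcal{H}_\alpha}\in\mathscr{L}(\mathcal{H}_\alpha,\mathcal{K}_\alpha)$ (bounded operators)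 for all $\alpha$, and $R_{\alpha\beta}T_\beta=T_\alpha P_{\alpha\beta}$ for $\alpha\le\beta$, where $P_{\alpha\beta}:\mathcal{H}_\beta\to\mathcal{H}_\alpha$ and $R_{\alpha\beta}:\mathcal{K}_\beta\to\mathcal{K}_\alpha$ are the orthogonal projections. The adjoint $T^*\in\mathscr{L}(\mathcal{K},\mathcal{H})$ is given by $T^*|_{\mathcal{K}_\alpha}=T_\alpha^*$. $\mathscr{L}(\mathcal{H},\mathcal{K})$ carries the topology of the seminorms $T\mapsto\|T_\alpha\|$; $\mathscr{L}(\mathcal{H})=\mathscr{L}(\mathcal{H},\mathcal{H})$ is a locally $C^*$-algebra. A unitary operator is $U\in\mathscr{L}(\mathcal{H},\mathcal{K})$ with $U^*U=I$, $UU^*=I$. Positivity: a linear map $\varphi:\mathscr{A}\to\mathscr{B}$ of locally $C^*$-algebras is positive if $\varphi(a^*a)\ge0$ for all $a$, and completely positive if all entrywise maps $\mathbb{M}_m(\mathscr{A})\to\mathbb{M}_m(\mathscr{B})$ are positive. A matrix $[\varphi]=(\varphi_{ij})_{i,j=1}^n$ of linear maps $\mathscr{A}\to\mathscr{B}$ is a completely $n$-positive map from $\mathscr{A}$ to $\mathscr{B}$ if $(a_{ij})\mapsto(\varphi_{ij}(a_{ij}))$ is completely positive from $\mathbb{M}_n(\mathscr{A})$ to $\mathbb{M}_n(\mathscr{B})$. An $n\times n$ matrix $[\Phi]=(\Phi_{ij})$ of continuous linear maps $\Phi_{ij}:\mathcal{M}\to\mathscr{L}(\mathcal{H},\mathcal{K})$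 is $[\varphi]$-completely positive, where $[\varphi]$ is a continuous completely $n$-positive map from $\mathscr{A}$ to $\mathscr{L}(\mathcal{H})$, if $\sum_{r=1}^n\Phi_{ri}(x)^*\Phi_{rj}(y)=\varphi_{ij}(\langle x,y\rangle)$ for all $x,y\in\mathcal{M}$ and all $i,j$. A representation of $\mathcal{M}$ on locally Hilbert spaces $H,K$ is a continuous linear map $\pi:\mathcal{M}\to\mathscr{L}(H,K)$ for which there is a continuous $*$-representation $\pi^\varphi:\mathscr{A}\to\mathscr{L}(H)$ with $\pi(x)^*\pi(y)=\pi^\varphi(\langle x,y\rangle)$ for all $x,y\in\mathcal{M}$; $\pi$ is then said to be associated with $\pi^\varphi$. A Stinespring representation of $([\varphi],[\Phi])$ is a tuple $(\pi,H,K,S_1,\dots,S_n,W_1,\dots,W_n)$ where $H,K$ are locally Hilbert spaces, $\pi:\mathcal{M}\to\mathscr{L}(H,K)$ is a representation associated with a continuous $*$-homomorphism $\pi^\varphi:\mathscr{A}\to\mathscr{L}(H)$, $S_i\in\mathscr{L}(\mathcal{H},H)$, $W_i\in\mathscr{L}(\mathcal{K},K)$, and $\varphi_{ij}(a)=S_i^*\pi^\varphi(a)S_j$, $\Phi_{ij}(x)=W_i^*\pi(x)S_j$ for all $a\in\mathscr{A}$, $x\in\mathcal{M}$, $i,j\in\{1,\dots,n\}$. It is minimal if $H=\big[\bigcup_{i=1}^n\pi^\varphi(\mathscr{A})S_i(\mathcal{H})\big]$ and $K=\big[\bigcup_{i=1}^n\pi(\mathcal{M})S_i(\mathcal{H})\big]$,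 where $[Y]$ denotes the closed linear subspace generated by $Y$. *)

(* Defs.v *)
From HB Require Import structures.
From mathcomp Require Import all_boot all_order all_algebra.
From mathcomp Require Import complex.
From mathcomp Require Import boolp classical_sets functions filter reals.
From mathcomp Require Import topology normedtype.
From mathcomp Require Import ring lra.

Set Implicit Arguments.
Unset Strict Implicit.
Unset Printing Implicit Defensive.

Import Order.TTheory GRing.Theory Num.Theory.
Import numFieldNormedType.Exports.

Local Open Scope classical_set_scope.
Local Open Scope ring_scope.

HB.mixin Record isDirected d T of Order.POrder d T := {
  directedP : forall x y : T, exists z, (x <= z)%O /\ (y <= z)%O
}.

#[short(type="directedType")]
HB.structure Definition Directed d := {T of Order.POrder d T & isDirected d T}.

(* The topology given by a family of seminorms [p : I -> V -> R]. All families
   used below are nonempty and upward directed, so the sets [sball i e x] are a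
   basis of neighbourhoods of [x]. *)
Section SeminormTopology.
Context {R : realType} {V : zmodType} {I : Type}.
Variable p : I -> V -> R.

Definition sball (i : I) (e : R) (x : V) : set V := [set y | p i (y - x) < e].

Definition snbhs (x : V) : set_system V :=
  [set U | exists i, exists2 e, 0 < e & sball i e x `<=` U].

Definition sclosure (S : set V) : set V :=
  [set x | forall U, snbhs x U -> S `&` U !=set0].

Definition scauchy (F : set_system V) :=
  forall i e, 0 < e -> exists x, F (sball i e x).

Definition scomplete (D : set V) := forall F : set_system V,
  ProperFilter F -> F D -> scauchy F -> exists2 x, D x & F --> snbhs x.

End SeminormTopology.

Definition scontinuous {R : realType} {V W : zmodType} {I J : Type}
    (p : I -> V -> R) (q : J -> W -> R) (f : V -> W) :=
  forall x, f @ snbhs p x --> snbhs q (f x).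

Section LinearSpan.
Context {R : realType} {V : lmodType R[i]}.

Definition seminorm (p : V -> R) :=
  (forall x y, p (x + y) <= p x + p y) /\
  (forall (c : R[i]) x, (p (c *: x))%:C%C = `|c| * (p x)%:C%C).

Definition lspan (S : set V) : set V :=
  [set x | exists n (c : 'I_n -> R[i]) (v : 'I_n -> V),
    (forall i, S (v i)) /\ x = \sum_i c i *: v i].

Definition linear_subspace (D : set V) :=
  D 0 /\ forall (c : R[i]) x y, D x -> D y -> D (c *: x + y).

End LinearSpan.

HB.mixin Record isStarRing A of GRing.PzRing A := {
  star : A -> A;
  starK : involutive star;
  starD : forall a b, star (a + b) = star a + star b;
  starM : forall a b, star (a * b) = star b * star a
}.

#[short(type="starRingType")]
HB.structure Definition StarRing := {A of GRing.PzRing A & isStarRing A}.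

Section StarRingTheory.
Variable A : starRingType.

Lemma star0 : star (0 : A) = 0.
Proof. by apply: (addrI (star 0)); rewrite -starD !addr0. Qed.

Lemma star_sum I (r : seq I) (P : pred I) (F : I -> A) :
  star (\sum_(i <- r | P i) F i) = \sum_(i <- r | P i) star (F i).
Proof. exact: (big_morph _ (@starD A) star0). Qed.

(* a >= 0 in a locally C*-algebra: a is of the form c^* c *)
Definition star_ge0 (a : A) := exists c : A, a = star c * c.

End StarRingTheory.

Section MatrixStar.
Variables (A : starRingType) (n : nat).
Implicit Types X Y : 'M[A]_n.

Definition mxstar X : 'M[A]_n := \matrix_(i, j) star (X j i).

Lemma mxstarK : involutive mxstar.
Proof. by move=> X; apply/matrixP => i j; rewrite !mxE starK. Qed.

Lemma mxstarD X Y : mxstar (X + Y) = mxstar X + mxstar Y.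
Proof. by apply/matrixP => i j; rewrite !mxE starD. Qed.

Lemma mxstarM X Y : mxstar (X * Y) = mxstar Y * mxstar X.
Proof.
apply/matrixP => i j; rewrite !mxE star_sum; apply: eq_bigr => k _.
by rewrite !mxE starM.
Qed.

HB.instance Definition _ := isStarRing.Build 'M[A]_n mxstarK mxstarD mxstarM.

End MatrixStar.

Section CompletePositivity.
Context {A B : starRingType}.

Definition positive_map (f : A -> B) := forall a, star_ge0 (f (star a * a)).

End CompletePositivity.

Definition completely_positive {A B : starRingType} (f : A -> B) :=
  forall m, positive_map (fun X : 'M[A]_m => map_mx f X).

Definition completely_n_positive {A B : starRingType} {n : nat}
    (phi : 'I_n -> 'I_n -> A -> B) :=
  completely_positive
    (fun X : 'M[A]_n => \matrix_(i, j) phi i j (X i j) : 'M[B]_n).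

Definition star_morphism {A B : starRingType} (f : A -> B) :=
  (forall a b, f (a * b) = f a * f b) /\ (forall a, f (star a) = star (f a)).

HB.mixin Record StarRing_isStarAlgebra (C : numClosedFieldType) A
    of StarRing A & GRing.Algebra C A := {
  starZ : forall (c : C) (a : A), star (c *: a) = c^* *: star a
}.

#[short(type="starAlgType")]
HB.structure Definition StarAlgebra (C : numClosedFieldType) :=
  {A of StarRing A & GRing.Algebra C A & StarRing_isStarAlgebra C A}.

Definition cstar_seminorm {R : realType} {A : starAlgType R[i]} (p : A -> R) :=
  [/\ seminorm p, forall a b, p (a * b) <= p a * p b,
      forall a, p (star a) = p a & forall a, p (star a * a) = p a ^+ 2].

(* The index set Delta is the directed set S(A) of all continuous
   C*-seminorms, with the pointwise order. *)
HB.mixin Record isLocCstar (R : realType) d (Delta : directedType d) A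
    of StarAlgebra R[i] A := {
  cnorm : Delta -> A -> R;
  cnorm_cstar : forall alpha, cstar_seminorm (cnorm alpha);
  cnorm_le : forall alpha beta,
    (alpha <= beta)%O <-> (forall a, cnorm alpha a <= cnorm beta a);
  cnorm_all : forall q : A -> R, cstar_seminorm q ->
    (forall a, q @ snbhs cnorm a --> q a) -> exists alpha, cnorm alpha = q;
  cnorm_hausdorff : forall a, (forall alpha, cnorm alpha a = 0) -> a = 0;
  cnorm_complete : scomplete cnorm setT
}.

#[short(type="locCstarType")]
HB.structure Definition LocCstar (R : realType) d (Delta : directedType d) :=
  {A of StarAlgebra R[i] A & isLocCstar R d Delta A}.

HB.mixin Record isHilbertModule (R : realType) d (Delta : directedType d)
    (A : locCstarType R Delta) M of GRing.Lmodule R[i] M := {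
  ract : M -> A -> M;
  ractDl : forall x y a, ract (x + y) a = ract x a + ract y a;
  ractDr : forall x a b, ract x (a + b) = ract x a + ract x b;
  ractM : forall x a b, ract x (a * b) = ract (ract x a) b;
  ract1 : forall x, ract x 1 = x;
  ractZl : forall (c : R[i]) x a, ract (c *: x) a = c *: ract x a;
  ractZr : forall (c : R[i]) x a, ract x (c *: a) = c *: ract x a;
  hmdot : M -> M -> A;
  hmdotDr : forall x y z, hmdot x (y + z) = hmdot x y + hmdot x z;
  hmdotZr : forall x (c : R[i]) y, hmdot x (c *: y) = c *: hmdot x y;
  hmdotAr : forall x y a, hmdot x (ract y a) = hmdot x y * a;
  hmdot_star : forall x y, hmdot y x = star (hmdot x y);
  hmdot_ge0 : forall x, star_ge0 (hmdot x x);
  hmdot_eq0 : forall x, hmdot x x = 0 -> x = 0;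
  hmdot_complete :
    scomplete (fun alpha x => Num.sqrt (cnorm alpha (hmdot x x))) setT
}.

#[short(type="hilbertModType")]
HB.structure Definition HilbertModule (R : realType) d (Delta : directedType d)
    (A : locCstarType R Delta) :=
  {M of GRing.Lmodule R[i] M & isHilbertModule R d Delta A M}.

Definition hmnorm {R : realType} {d} {Delta : directedType d}
    {A : locCstarType R Delta} {M : hilbertModType A} (alpha : Delta) (x : M) : R :=
  Num.sqrt (cnorm alpha (hmdot x x)).

Definition dot_norm {R : realType} {V : lmodType R[i]}
    (dot : V -> V -> R[i]) (x : V) : R := Num.sqrt (complex.Re (dot x x)).

(* V is the union of the Hilbert spaces [lhsub alpha]. As [lhsub alpha] is a
   subspace of the Hilbert space [lhsub beta] for alpha <= beta, all inner
   products are restrictions of a single one, [lhdot]. It follows the library's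
   convention: linear in the first variable. Completeness makes [lhsub alpha]
   closed in [lhsub beta]. *)
HB.mixin Record isLocHilbert (R : realType) d (Delta : directedType d) V
    of GRing.Lmodule R[i] V := {
  lhdot : {dot V for @Num.conj R[i]};
  lhsub : Delta -> set V;
  lhsub_linear : forall alpha, linear_subspace (lhsub alpha);
  lhsub_le : forall alpha beta, (alpha <= beta)%O -> lhsub alpha `<=` lhsub beta;
  lhsub_cover : forall x, exists alpha, lhsub alpha x;
  lhsub_complete : forall alpha,
    scomplete (fun _ : unit => dot_norm lhdot) (lhsub alpha)
}.

#[short(type="locHilbertType")]
HB.structure Definition LocHilbert (R : realType) d (Delta : directedType d) :=
  {V of GRing.Lmodule R[i] V & isLocHilbert R d Delta V}.

Section LocHilbertTopology.
Context {R : realType} {d : Order.disp_t} {Delta : directedType d}.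
Variable H : locHilbertType R Delta.

Definition lhnorm (x : H) : R := dot_norm lhdot x.

(* The inductive limit topology is the finest locally convex topology for which
   the inclusions of the [lhsub alpha] are continuous: it is given by all the
   seminorms whose restriction to each [lhsub alpha] is norm continuous. *)
Definition ind_seminorm (p : H -> R) :=
  seminorm p /\ forall alpha (x : H), lhsub alpha x ->
    p @ within (lhsub alpha) (snbhs (fun _ : unit => lhnorm) x) --> p x.

Definition ind_seminorms (p : {p : H -> R | ind_seminorm p}) : H -> R :=
  projT1 p.

Definition closed_span (S : set H) : set H := sclosure ind_seminorms (lspan S).

(* On [lhsub beta], beta >= alpha, this is the orthogonal projection onto the
   closed subspace [lhsub alpha]; see [lhprojP] for its existence. *)
Definition lhproj (alpha : Delta) (x : H) : H :=
  xget 0 [set y | lhsub alpha y /\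
                  forall z, lhsub alpha z -> lhdot (x - y) z = 0].

End LocHilbertTopology.

Section Riesz.
Context {R : realType} {V : lmodType R[i]} (dot : {dot V for @Num.conj R[i]}).
Implicit Types x y z : V.

Let rdot x y : R := complex.Re (dot x y).
Let nrm x : R := dot_norm dot x.

Let ReD (a b : R[i]) : complex.Re (a + b) = complex.Re a + complex.Re b.
Proof. by case: a => ? ?; case: b. Qed.

Let ReN (a : R[i]) : complex.Re (- a) = - complex.Re a.
Proof. by case: a. Qed.

Let ReZ (r : R) (a : R[i]) : complex.Re (r%:C%C * a) = r * complex.Re a.
Proof. by case: a => a b /=; rewrite mul0r subr0. Qed.

Let Rei (a : R[i]) : complex.Re ('i%C * a) = - complex.Im a.
Proof. by case: a => a b /=; rewrite mul0r mul1r sub0r. Qed.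

Let ReC (a : R[i]) : complex.Re a^* = complex.Re a.
Proof. by case: a. Qed.

Let dotC x y : dot y x = (dot x y)^*.
Proof. by rewrite hermC /= expr0 mul1r. Qed.

Let rdotC x y : rdot x y = rdot y x.
Proof. by rewrite /rdot [dot y x]dotC ReC. Qed.

Let rdotDl x y z : rdot (x + y) z = rdot x z + rdot y z.
Proof. by rewrite /rdot linearDl ReD. Qed.

Let rdotDr x y z : rdot z (x + y) = rdot z x + rdot z y.
Proof. by rewrite ![rdot z _]rdotC rdotDl. Qed.

Let rdotZl (r : R) x y : rdot (r%:C%C *: x) y = r * rdot x y.
Proof. by rewrite /rdot linearZl_LR ReZ. Qed.

Let rdotZr (r : R) x y : rdot x (r%:C%C *: y) = r * rdot x y.
Proof. by rewrite rdotC rdotZl rdotC. Qed.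

Let rdotNl x y : rdot (- x) y = - rdot x y.
Proof. by rewrite /rdot linearNl ReN. Qed.

Let rdotNr x y : rdot x (- y) = - rdot x y.
Proof. by rewrite rdotC rdotNl rdotC. Qed.

Let rdotiZl x y : complex.Re (dot ('i%C *: x) y) = - complex.Im (dot x y).
Proof. by rewrite linearZl_LR Rei. Qed.

Let rdot_ge0 x : 0 <= rdot x x.
Proof. by have := dnorm_ge0 dot x; rewrite lecE => /andP[]. Qed.

Let nrm_ge0 x : 0 <= nrm x. Proof. exact: sqrtr_ge0. Qed.

Let nrm_sqr x : nrm x ^+ 2 = rdot x x.
Proof. by rewrite sqr_sqrtr ?rdot_ge0. Qed.

Lemma dotxxE x : dot x x = (dot_norm dot x ^+ 2)%:C%C.
Proof.
have := dnorm_ge0 dot x; rewrite nrm_sqr /rdot lecE => /andP[/eqP + _].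
by case: (dot x x) => a b /= ->.
Qed.

Lemma dot_norm0 : dot_norm dot 0 = 0.
Proof. by rewrite /dot_norm linear0r sqrtr0. Qed.

Lemma dot_norm_eq0 x : dot_norm dot x = 0 -> x = 0.
Proof.
move=> x0; apply/eqP; rewrite -(dnorm_eq0 dot); apply/eqP.
by rewrite dotxxE x0 expr0n.
Qed.

Let rdot_sqr_le x y : rdot x y ^+ 2 <= rdot x x * rdot y y.
Proof.
have [y0|y0] := eqVneq (rdot y y) 0.
  have -> : y = 0 by apply: dot_norm_eq0; rewrite -/(nrm y) /nrm /dot_norm -/(rdot y y) y0 sqrtr0.
  by rewrite /rdot !linear0r /= mulr0 expr0n.
have yp : 0 < rdot y y by rewrite lt_def y0 rdot_ge0.
have := rdot_ge0 ((rdot y y)%:C%C *: x - (rdot x y)%:C%C *: y).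
rewrite !(rdotDl, rdotDr, rdotNl, rdotNr, rdotZl, rdotZr) (rdotC y x).
set a := rdot y y; set b := rdot x y; set c := rdot x x => h.
have : 0 <= a * (c * a - b ^+ 2) by move: h; congr (_ <= _); ring.
by rewrite pmulr_rge0 // subr_ge0.
Qed.

Let rdot_le x y : `|rdot x y| <= nrm x * nrm y.
Proof.
rewrite -(@ler_pXn2r _ 2) ?nnegrE ?mulr_ge0 ?nrm_ge0 //.
by rewrite real_normK ?num_real // exprMn !nrm_sqr rdot_sqr_le.
Qed.

Lemma Re_dot_le x y :
  `|complex.Re (dot x y)| <= dot_norm dot x * dot_norm dot y.
Proof. exact: rdot_le. Qed.

Lemma dot_normZ (a : R[i]) x :
  dot_norm dot (a *: x) = complex.Re `|a| * dot_norm dot x.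
Proof.
have na0 : 0 <= complex.Re `|a| by rewrite normc_def /= sqrtr_ge0.
apply/eqP; rewrite -(@eqrXn2 _ 2) ?mulr_ge0 ?nrm_ge0 ?sqrtr_ge0 //.
rewrite exprMn -!/(nrm _) !nrm_sqr /rdot dnormZ normc_def /=.
rewrite -rmorphXn /= ReZ sqr_sqrtr //.
by rewrite addr_ge0 ?sqr_ge0.
Qed.

Lemma dot_normD x y : dot_norm dot (x + y) <= dot_norm dot x + dot_norm dot y.
Proof.
rewrite -(@ler_pXn2r _ 2) ?nnegrE ?addr_ge0 ?sqrtr_ge0 //.
rewrite -/(nrm x) -/(nrm y) -/(nrm (x + y)) sqrrD !nrm_sqr.
rewrite rdotDl !rdotDr (rdotC y x).
have := le_trans (ler_norm _) (rdot_le x y); lra.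
Qed.

Lemma dot_inj x y (D : set V) : linear_subspace D -> D x -> D y ->
  (forall z, D z -> dot z x = dot z y) -> x = y.
Proof.
move=> [_ Dl] Dx Dy xy; apply/eqP; rewrite -subr_eq0 -(dnorm_eq0 dot); apply/eqP.
have Dxy : D (x - y) by rewrite addrC -scaleN1r; apply: Dl.
have -> : dot (x - y) (x - y) = dot (x - y) x - dot (x - y) y by rewrite linearBr.
by rewrite xy // subrr.
Qed.

Variables (D : set V) (Dlin : linear_subspace D).
Hypothesis Dcomplete : scomplete (fun _ : unit => dot_norm dot) D.
Variables (f : V -> R[i]) (c : R).
Hypothesis c_ge0 : 0 <= c.
Hypothesis f_linear :
  forall (a : R[i]) x y, D x -> D y -> f (a *: x + y) = a * f x + f y.
Hypothesis f_bounded : forall x, D x -> `|complex.Re (f x)| <= c * dot_norm dot x.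

Let D0 : D 0. Proof. by case: Dlin. Qed.
Let DZ a x : D x -> D (a *: x).
Proof. by move=> Dx; rewrite -[a *: x]addr0; apply: (Dlin).2. Qed.
Let DD x y : D x -> D y -> D (x + y).
Proof. by move=> Dx Dy; rewrite -[x]scale1r; apply: (Dlin).2. Qed.
Let DB x y : D x -> D y -> D (x - y).
Proof. by move=> Dx Dy; rewrite addrC -scaleN1r; apply: (Dlin).2. Qed.

Let g x := complex.Re (f x).
Let f0 : f 0 = 0.
Proof.
have := f_linear 1 D0 D0; rewrite scale1r addr0 mul1r => /esym/eqP.
by rewrite -subr_eq0 addrK => /eqP.
Qed.
Let fZ a x : D x -> f (a *: x) = a * f x.
Proof. by move=> Dx; rewrite -[a *: x]addr0 f_linear // f0 addr0. Qed.
Let gD x y : D x -> D y -> g (x + y) = g x + g y.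
Proof.
move=> Dx Dy; rewrite /g -[x]scale1r f_linear // mul1r scale1r.
by rewrite ReD.
Qed.
Let gZ (r : R) x : D x -> g (r%:C%C *: x) = r * g x.
Proof. by move=> Dx; rewrite /g fZ // ReZ. Qed.
Let gB x y : D x -> D y -> g (x - y) = g x - g y.
Proof.
move=> Dx Dy; rewrite addrC -scaleN1r.
have -> : (-1 : R[i]) = (-1 : R)%:C%C by rewrite rmorphN1.
by rewrite gD ?gZ ?mulN1r; first (by rewrite addrC); rewrite //; apply: DZ.
Qed.

Let J x : R := rdot x x - 2 * g x.

Let JD x z : D x -> D z -> J (x + z) = J x + 2 * (rdot z x - g z) + rdot z z.
Proof.
move=> Dx Dz; rewrite /J gD // !(rdotDl, rdotDr) (rdotC x z).
set a := rdot _ _; set b := rdot _ _; set e := rdot _ _; ring.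
Qed.

Let J_ge x : D x -> - c ^+ 2 <= J x.
Proof.
move=> Dx; rewrite /J -nrm_sqr; have := f_bounded Dx.
rewrite -/(g x) -/(nrm x) => /(le_trans (ler_norm _)) h.
have := sqr_ge0 (nrm x - c); nra.
Qed.

Let m := inf (J @` D).

Let m_has_inf : has_inf (J @` D).
Proof.
split; first by exists (J 0), 0.
by exists (- c ^+ 2) => _ [x Dx <-]; apply: J_ge.
Qed.

Let m_le x : D x -> m <= J x.
Proof. by move=> Dx; apply: ge_inf; [case: m_has_inf | exists x]. Qed.

Let near_min e : 0 < e -> exists2 x, D x & J x < m + e.
Proof.
move=> e0; have [_ [x Dx <-] Jx] := inf_adherent e0 m_has_inf.
by exists x.
Qed.

Let parallelogram x y : D x -> D y -> rdot (x - y) (x - y) <= 2 * (J x + J y - 2 * m).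
Proof.
move=> Dx Dy.
pose h : R[i] := (2^-1 : R)%:C%C.
have := m_le (DZ h (DD Dx Dy)); rewrite /J gZ ?gD //; last exact: DD.
rewrite !(rdotDl, rdotDr, rdotZl, rdotZr, rdotNl, rdotNr) (rdotC y x).
lra.
Qed.

Let minF : set_system V :=
  [set U | exists2 e, 0 < e & [set x | D x /\ J x < m + e] `<=` U].

Let minF_proper : ProperFilter minF.
Proof.
split.
  by case=> e e0 sub0; have [x Dx Jx] := near_min e0; apply: (sub0 x).
split.
- by exists 1.
- move=> P Q [e e0 eP] [e' e'0 e'Q]; exists (Num.min e e').
    by rewrite lt_min e0.
  move=> x [Dx]; rewrite -ltrBlDl lt_min => /andP[h h'].
  by split; [apply: eP|apply: e'Q]; split; rewrite // -ltrBlDl.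
- by move=> P Q PQ [e e0 eP]; exists e => //; apply: subset_trans PQ.
Qed.

Let minF_cauchy : scauchy (fun _ : unit => dot_norm dot) minF.
Proof.
move=> i e e0; have e'0 : 0 < e ^+ 2 / 8 by rewrite divr_gt0 // exprn_gt0.
have [x Dx Jx] := near_min e'0; exists x, (e ^+ 2 / 8) => // y [Dy Jy].
rewrite /sball /= -/(nrm _) -(@ltr_pXn2r _ 2) ?nnegrE ?nrm_ge0 ?ltW //.
by rewrite nrm_sqr; apply: le_lt_trans (parallelogram Dy Dx) _; lra.
Qed.

Let J_min : exists2 y, D y & J y = m.
Proof.
have [|y Dy Fy] := Dcomplete minF_proper _ minF_cauchy.
  by exists 1 => // x [].
exists y => //; apply/le_anti; rewrite m_le // andbT.
apply/ler_addgt0Pr => e e0.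
pose k := 2 * (nrm y + c) + 1.
have k0 : 0 < k.
  by rewrite /k; have := nrm_ge0 y; have := c_ge0; lra.
pose d := e / 2 / k.
have d0 : 0 < d by rewrite !divr_gt0.
have [z [[Dz Jz] yz]] : (([set x | D x /\ J x < m + e / 2] : set V) `&`
    sball (fun _ : unit => dot_norm dot) tt d y) !=set0.
  apply: (@filter_ex _ minF minF_proper); apply: (@filterI _ minF (@filter_filter _ _ minF_proper)).
    by exists (e / 2) => //; rewrite divr_gt0.
  by apply: Fy; exists tt, d.
have : J (y + (z - y)) < m + e / 2 by rewrite addrC subrK.
have Dzy := DB Dz Dy.
rewrite JD //; move: yz (rdot_le (z - y) y) (f_bounded Dzy) (rdot_ge0 (z - y)).
rewrite /sball /= -/(nrm _) -/(nrm _) -/(g _).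
rewrite !ler_norml => yz /andP[h1 _] /andP[_ h2] h3 h4.
have dk : d * k = e / 2 by rewrite /d divfK // gt_eqF.
have h5 : nrm (z - y) * (nrm y + c) <= d * (nrm y + c).
  by rewrite ler_wpM2r ?addr_ge0 ?nrm_ge0 ?c_ge0 ?ltW.
move: dk h5; rewrite /k; lra.
Qed.

Lemma riesz : exists2 y, D y & forall z, D z -> f z = dot z y.
Proof.
have [y Dy Jy] := J_min; exists y => //.
have ReE z : D z -> g z = rdot z y.
  move=> Dz; pose a := rdot z y - g z; pose b := rdot z z.
  have b1 : 0 < b + 1 by rewrite ltr_wpDl ?rdot_ge0.
  pose t := - a / (b + 1).
  have ta : a = - (t * (b + 1)) by rewrite /t divfK ?opprK // gt_eqF.
  have := m_le (DD Dy (DZ t%:C%C Dz)).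
  rewrite JD // ?Jy; last exact: DZ.
  rewrite gZ // rdotZl rdotZl rdotZr -/b -mulrBr -/a ta => h.
  have : t ^+ 2 <= 0 by have := rdot_ge0 z; rewrite -/b; nra.
  move=> t2; have /eqP : t ^+ 2 = 0 by apply/le_anti; rewrite t2 sqr_ge0.
  rewrite sqrf_eq0 => /eqP t0; apply/esym/eqP; rewrite -subr_eq0 -/a ta t0.
  by rewrite mul0r oppr0.
move=> z Dz; apply/eqP; rewrite eq_complex; apply/andP; split; apply/eqP.
  exact: ReE.
have := ReE _ (DZ 'i%C Dz).
by rewrite /g fZ // Rei /rdot rdotiZl => /oppr_inj.
Qed.

End Riesz.

Section LocHilbertTheory.
Context {R : realType} {d : Order.disp_t} {Delta : directedType d}.
Variable H : locHilbertType R Delta.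
Implicit Types (x y z : H) (alpha beta : Delta).

Lemma lhdotC x y : lhdot y x = (lhdot x y)^*.
Proof. by rewrite hermC /= expr0 mul1r. Qed.

Lemma lhsub0 alpha : lhsub alpha (0 : H).
Proof. by case: (@lhsub_linear R d Delta H alpha). Qed.

Lemma lhsubP alpha (c : R[i]) x y :
  lhsub alpha x -> lhsub alpha y -> lhsub alpha (c *: x + y).
Proof. by case: (@lhsub_linear R d Delta H alpha) => _; apply. Qed.

Lemma lhsub_cover2 alpha x : exists beta, (alpha <= beta)%O /\ lhsub beta x.
Proof.
have [gamma xg] := @lhsub_cover R d Delta H x.
have [beta [ab gb]] := directedP alpha gamma.
by exists beta; split => //; apply: lhsub_le gb _ xg.
Qed.

Lemma lhprojP alpha x : lhsub alpha (lhproj alpha x) /\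
  forall z, lhsub alpha z -> lhdot (x - lhproj alpha x) z = 0.
Proof.
rewrite /lhproj; apply: (@xgetPex _ 0 [set y | lhsub alpha y /\
  forall z, lhsub alpha z -> lhdot (x - y) z = 0]).
have [|a u v _ _|z _|y Dy xy] := riesz (@lhsub_linear R d Delta H alpha)
  (@lhsub_complete R d Delta H alpha) (c := lhnorm x) (f := lhdot^~ x).
- exact: sqrtr_ge0.
- by rewrite linearPl.
- by rewrite mulrC; apply: Re_dot_le.
exists y; split => // z /xy zxy.
by rewrite lhdotC linearBr /= zxy subrr conjC0.
Qed.

Lemma lhprojE alpha x y : lhsub alpha y ->
  (forall z, lhsub alpha z -> lhdot (x - y) z = 0) -> lhproj alpha x = y.
Proof.
move=> ya xy; have [pa xp] := lhprojP alpha x.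
apply: (dot_inj (dot := lhdot) (@lhsub_linear R d Delta H alpha) pa ya) => z za.
have := xp z za; have := xy z za.
rewrite !linearBl /= => /eqP; rewrite subr_eq0 => /eqP e1 /eqP.
by rewrite subr_eq0 => /eqP e2; rewrite lhdotC -e2 e1 -lhdotC.
Qed.

End LocHilbertTheory.

Section Operators.
Context {R : realType} {d : Order.disp_t} {Delta : directedType d}.
Variables H K : locHilbertType R Delta.

(* T maps H_alpha to K_alpha, its restriction T_alpha is bounded, and
   R_{alpha beta} T_beta = T_alpha P_{alpha beta} *)
Definition is_lhop : set (H -> K) := [set T | [/\ linear T,
  forall alpha x, lhsub alpha x -> lhsub alpha (T x),
  forall alpha, exists c, forall x, lhsub alpha x -> lhnorm (T x) <= c * lhnorm x &
  forall alpha beta, (alpha <= beta)%O -> forall x, lhsub beta x ->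
    lhproj alpha (T x) = T (lhproj alpha x)]].

Definition lhop_pred : {pred H -> K} := mem is_lhop.

Record lhop := LHop { lhop_fun :> H -> K; lhopP : lhop_fun \in lhop_pred }.

HB.instance Definition _ := [isSub of lhop for lhop_fun].
HB.instance Definition _ := [Choice of lhop by <:].


Implicit Types (T S : lhop) (alpha beta : Delta).

Lemma lhopW T : is_lhop T. Proof. exact: set_mem (lhopP T). Qed.

Definition mklhop (f : H -> K) (fP : is_lhop f) : lhop := LHop (mem_set fP).

Lemma lhop_eq T S : (forall x, T x = S x) -> T = S.
Proof. by move=> TS; apply: val_inj; apply/funext. Qed.

Lemma lhopL T : linear T. Proof. by case: (lhopW T). Qed.

HB.instance Definition _ T :=
  GRing.isLinear.Build R[i] H K *:%R (lhop_fun T) (lhopL T).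

Lemma lhop_sub T alpha x : lhsub alpha x -> lhsub alpha (T x).
Proof. by case: (lhopW T) => _ h _ _; apply: h. Qed.

Lemma lhop_bounded T alpha : exists2 c, 0 <= c &
  forall x, lhsub alpha x -> lhnorm (T x) <= c * lhnorm x.
Proof.
case: (lhopW T) => _ _ h _; have [c hc] := h alpha.
exists `|c| => // x /hc /le_trans; apply.
by rewrite ler_wpM2r ?sqrtr_ge0 // ler_norm.
Qed.

Lemma lhop_proj T alpha x : lhproj alpha (T x) = T (lhproj alpha x).
Proof.
have [beta [ab xb]] := lhsub_cover2 alpha x.
by case: (lhopW T) => _ _ _ h; apply: h ab _ xb.
Qed.

Lemma is_lhop_submod_closed : subsemimod_closed lhop_pred.
Proof.
apply: GRing.submod_closed_semi; split.
  apply/mem_set; split.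
  - by move=> c x y; rewrite scaler0 addr0.
  - by move=> alpha x _; apply: lhsub0.
  - move=> alpha; exists 0 => x _.
    by rewrite mul0r /lhnorm dot_norm0.
  - move=> alpha beta _ x _; apply: lhprojE; first exact: lhsub0.
    by move=> z _; rewrite subrr linear0l.
move=> c f g /set_mem fP /set_mem gP.
pose F := mklhop fP; pose G := mklhop gP.
apply/mem_set; rewrite (_ : c *: f + g = fun x => c *: F x + G x) //; split.
- move=> a x y; rewrite !lhopL !scalerDr !scalerA (mulrC c a) addrACA.
  by rewrite -!scalerA.
- by move=> alpha x xa; apply: lhsubP; apply: lhop_sub.
- move=> alpha; have [a a0 Fa] := lhop_bounded F alpha.
  have [b b0 Gb] := lhop_bounded G alpha.
  exists (complex.Re `|c| * a + b) => x xa.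
  apply: (le_trans (dot_normD _ _ _)); rewrite mulrDl lerD // ?Gb //.
  by rewrite dot_normZ -mulrA ler_wpM2l // ?Fa //; rewrite normc_def /= sqrtr_ge0.
- move=> alpha beta ab x xb; have [pF oF] := lhprojP alpha (F x).
  have [pG oG] := lhprojP alpha (G x).
  rewrite -!lhop_proj; apply: lhprojE; first exact: lhsubP.
  move=> z za; rewrite opprD addrACA -scalerBr.
  by rewrite linearDl linearZl_LR /= oF // oG // mulr0 addr0.
Qed.

HB.instance Definition _ :=
  GRing.SubChoice_isSubLmodule.Build R[i] (H -> K) lhop_pred lhop
    is_lhop_submod_closed.

End Operators.

Section OperatorNorm.
Context {R : realType} {d : Order.disp_t} {Delta : directedType d}.
Context {H K : locHilbertType R Delta}.

(* the operator norm of the restriction T_alpha *)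
Definition opnorm (alpha : Delta) (T : lhop H K) : R :=
  sup [set lhnorm (T x) | x in [set x | lhsub alpha x /\ lhnorm x <= 1]].

End OperatorNorm.

Section Composition.
Context {R : realType} {d : Order.disp_t} {Delta : directedType d}.

Lemma is_lhop_id (H : locHilbertType R Delta) : is_lhop (@idfun H).
Proof.
split=> //; first by move=> alpha; exists 1 => x xa; rewrite mul1r.
Qed.

Definition lhop_id (H : locHilbertType R Delta) : lhop H H :=
  mklhop (is_lhop_id H).

Variables H K L : locHilbertType R Delta.
Variables (T : lhop K L) (S : lhop H K).

Lemma is_lhop_comp : is_lhop (T \o S).
Proof.
split=> [a x y|alpha x xa|alpha|alpha beta ab x xb] /=.
- by rewrite !lhopL.
- by do 2!apply: lhop_sub.
- have [a a0 Ta] := lhop_bounded T alpha; have [b b0 Sb] := lhop_bounded S alpha.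
  exists (a * b) => x xa; apply: le_trans (Ta _ _) _; first exact: lhop_sub.
  by rewrite -mulrA ler_wpM2l ?Sb.
- by rewrite !lhop_proj.
Qed.

Definition lhop_comp : lhop H L := mklhop is_lhop_comp.

End Composition.

Notation "T '\oL' S" := (lhop_comp T S)
  (at level 50, left associativity) : ring_scope.

Section Adjoint.
Context {R : realType} {d : Order.disp_t} {Delta : directedType d}.

(* S restricted to K_alpha is the Hilbert space adjoint of T_alpha *)
Definition is_adjoint {H K : locHilbertType R Delta} (T : lhop H K)
    (S : lhop K H) := forall alpha x y,
  lhsub alpha x -> lhsub alpha y -> lhdot (T x) y = lhdot x (S y).

Definition adj {H K : locHilbertType R Delta} (T : lhop H K) : lhop K H :=
  xget 0 (is_adjoint T).

Section Existence.
Variables H K : locHilbertType R Delta.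
Implicit Types (T : lhop H K) (x : H) (y : K).

Lemma is_adjoint_ex T : exists S, is_adjoint T S.
Proof.
have ex y : exists s : H, (forall alpha, lhsub alpha y -> lhsub alpha s) /\
    forall x, lhdot (T x) y = lhdot x s.
  have key alpha : lhsub alpha y -> exists2 s : H, lhsub alpha s &
      forall x, lhdot (T x) y = lhdot x s.
    move=> ya; have [c c0 Tc] := lhop_bounded T alpha.
    have [|a u v _ _|x xa|s sa Ts] := riesz (@lhsub_linear R d Delta H alpha)
      (@lhsub_complete R d Delta H alpha)
      (c := c * lhnorm y) (f := fun x => lhdot (T x) y).
    - by rewrite mulr_ge0 // sqrtr_ge0.
    - by rewrite lhopL linearPl.
    - apply: le_trans (Re_dot_le _ _ _) _.
      by rewrite mulrAC ler_wpM2r ?sqrtr_ge0 ?Tc.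
    exists s => // x.
    have [pa xp] := lhprojP alpha x; have [Ta Tp] := lhprojP alpha (T x).
    have -> : lhdot x s = lhdot (lhproj alpha x) s.
      by have /eqP := xp s sa; rewrite linearBl subr_eq0 => /eqP.
    rewrite -Ts // -lhop_proj.
    by have /eqP := Tp y ya; rewrite linearBl subr_eq0 => /eqP.
  have [alpha ya] := @lhsub_cover R d Delta K y.
  have [s _ Ts] := key alpha ya; exists s; split => // beta yb.
  have [s' s'b Ts'] := key beta yb; suff -> : s = s' by [].
  apply: (dot_inj (dot := lhdot) (D := setT)) => // z _.
  by rewrite -Ts -Ts'.
pose S y := projT1 (cid (ex y)).
have S1 y alpha : lhsub alpha y -> lhsub alpha (S y).
  by rewrite /S; case: (cid (ex y)) => s [h ?]; apply: h.
have S2 x y : lhdot (T x) y = lhdot x (S y).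
  by rewrite /S; case: (cid (ex y)) => s [? h]; apply: h.
suff SP : is_lhop S by exists (mklhop SP) => alpha x y _ _; apply: S2.
split=> [a y z|alpha y|alpha|alpha beta ab y yb].
- apply: (dot_inj (dot := lhdot) (D := setT)) => // x _.
  rewrite -S2 !linearPr /=; congr (_ * _ + _); exact: S2.
- exact: S1.
- have [c c0 Tc] := lhop_bounded T alpha; exists c => y ya.
  have := le_trans (ler_norm _) (Re_dot_le lhdot (T (S y)) y).
  rewrite S2 dotxxE /= -/(lhnorm _) -/(lhnorm _) -/(lhnorm _).
  have [-> _|n0] := eqVneq (lhnorm (S y)) 0.
    by rewrite mulr_ge0 // sqrtr_ge0.
  have np : 0 < lhnorm (S y) by rewrite lt_def n0 sqrtr_ge0.
  move=> h; rewrite -(ler_pM2l np) -expr2; apply: le_trans h _.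
  by rewrite mulrA ler_wpM2r ?sqrtr_ge0 // mulrC; apply: Tc; apply: S1.
- have [py yp] := lhprojP alpha y; apply: lhprojE; first exact: S1.
  move=> x xa; rewrite lhdotC.
  have -> : lhdot x (S y - S (lhproj alpha y)) = lhdot (T x) (y - lhproj alpha y).
    by rewrite !linearBr /=; congr (_ - _); rewrite S2.
  by rewrite lhdotC yp ?conjC0 //; apply: lhop_sub.
Qed.

Lemma adjP T x y : lhdot (T x) y = lhdot x (adj T y).
Proof.
have h : is_adjoint T (adj T) by apply: xgetPex; apply: is_adjoint_ex.
have [alpha xa] := @lhsub_cover R d Delta H x.
have [beta [ab yb]] := lhsub_cover2 alpha y.
by apply: (h beta) => //; apply: lhsub_le ab _ xa.
Qed.

Lemma adj_eq T (S : lhop K H) :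
  (forall x y, lhdot (T x) y = lhdot x (S y)) -> adj T = S.
Proof.
move=> TS; apply: lhop_eq => y.
apply: (dot_inj (dot := lhdot) (D := setT)) => // x _.
by rewrite -adjP TS.
Qed.

End Existence.

Lemma adjK (H K : locHilbertType R Delta) (T : lhop H K) : adj (adj T) = T.
Proof. by apply: adj_eq => y x; rewrite lhdotC -adjP -lhdotC. Qed.

Lemma adjD (H K : locHilbertType R Delta) (T S : lhop H K) :
  adj (T + S) = adj T + adj S.
Proof.
apply: adj_eq => x y; rewrite linearDl linearDr /=.
by congr (_ + _); apply: adjP.
Qed.

Lemma adj_comp (H K L : locHilbertType R Delta) (T : lhop K L) (S : lhop H K) :
  adj (T \oL S) = adj S \oL adj T.
Proof. by apply: adj_eq => x y; rewrite /= !adjP. Qed.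

End Adjoint.

Section OperatorAlgebra.
Context {R : realType} {d : Order.disp_t} {Delta : directedType d}.
Variable H : locHilbertType R Delta.
Implicit Types S T U : lhop H H.

Lemma lhop_compA : associative (fun S T => S \oL T).
Proof. by move=> S T U; apply: lhop_eq. Qed.

Lemma lhop_comp1l : left_id (lhop_id H) (fun S T => S \oL T).
Proof. by move=> S; apply: lhop_eq. Qed.

Lemma lhop_comp1r : right_id (lhop_id H) (fun S T => S \oL T).
Proof. by move=> S; apply: lhop_eq. Qed.

Lemma lhop_compDl : left_distributive (fun S T => S \oL T) +%R.
Proof. by move=> S T U; apply: lhop_eq. Qed.

Lemma lhop_compDr : right_distributive (fun S T => S \oL T) +%R.
Proof. by move=> S T U; apply: lhop_eq => x; rewrite /= linearD. Qed.

HB.instance Definition _ := GRing.Zmodule_isPzRing.Build (lhop H H)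
  lhop_compA lhop_comp1l lhop_comp1r lhop_compDl lhop_compDr.

HB.instance Definition _ := isStarRing.Build (lhop H H)
  (@adjK _ _ _ H H) (@adjD _ _ _ H H) (@adj_comp _ _ _ H H H).

End OperatorAlgebra.

Definition unitary {R : realType} {d} {Delta : directedType d}
    {H K : locHilbertType R Delta} (U : lhop H K) :=
  adj U \oL U = lhop_id H /\ U \oL adj U = lhop_id K.

Section Stinespring.
Context {R : realType} {d : Order.disp_t} {Delta : directedType d}.
Context {A : locCstarType R Delta} {M : hilbertModType A}.

Definition associated_representation {H K : locHilbertType R Delta}
    (piA : {linear A -> lhop H H}) (pi : {linear M -> lhop H K}) :=
  [/\ scontinuous hmnorm opnorm pi,
      scontinuous cnorm opnorm piA,
      star_morphism piA &
      forall x y, adj (pi x) \oL pi y = piA (hmdot x y)].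

Context {n : nat} {H K : locHilbertType R Delta}.
Variable phi : 'I_n -> 'I_n -> {linear A -> lhop H H}.
Variable Phi : 'I_n -> 'I_n -> {linear M -> lhop H K}.

Definition continuous_completely_n_positive :=
  (forall i j, scontinuous cnorm opnorm (phi i j)) /\ completely_n_positive phi.

Definition phi_completely_positive :=
  (forall i j, scontinuous hmnorm opnorm (Phi i j)) /\
  (forall x y i j,
    \sum_(r < n) (adj (Phi r i x) \oL Phi r j y) = phi i j (hmdot x y)).

Context {H' K' : locHilbertType R Delta}.
Variables (piA : {linear A -> lhop H' H'}) (pi : {linear M -> lhop H' K'}).
Variables (S : 'I_n -> lhop H H') (W : 'I_n -> lhop K K').

Definition stinespring_representation :=
  [/\ associated_representation piA pi,
      forall i j a, phi i j a = adj (S i) \oL piA a \oL S j &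
      forall i j x, Phi i j x = adj (W i) \oL pi x \oL S j].

Definition minimal_stinespring_representation :=
  [/\ stinespring_representation,
      closed_span (\bigcup_i [set z | exists a h, z = piA a (S i h)]) = setT &
      closed_span (\bigcup_i [set z | exists x h, z = pi x (S i h)]) = setT].

End Stinespring.

(* Main.v *)
Require Import Defs.
From HB Require Import structures.
From mathcomp Require Import all_boot all_order all_algebra.
From mathcomp Require Import complex.
From mathcomp Require Import boolp classical_sets functions filter reals.
From mathcomp Require Import topology normedtype.
From mathcomp Require Import ring lra.

Set Implicit Arguments.
Unset Strict Implicit.
Unset Printing Implicit Defensive.

Import Order.TTheory GRing.Theory Num.Theory.
Import numFieldNormedType.Exports.

Local Open Scope classical_set_scope.
Local Open Scope ring_scope.

(** The vectors [pi^phi(a) S_i h] have inner products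
    [<h, phi_ij(a^* b) k>], and the vectors [pi(x) S_i h] have inner products
    [<h, phi_ij(<x, y>) k>], so these Gram matrices are the same for any two
    minimal representations. The projection onto [H_alpha] sends such a vector
    to the one with [h] replaced by its projection; hence the vectors with [h]
    in [calH_alpha] span a dense subspace of [H_alpha], and the norm preserving
    correspondence between the two spans extends to each Hilbert space
    [H_alpha] compatibly with the projections. *)

(** * Dense spans and orthogonal projections in a locally Hilbert space *)

Section Density.
Context {R : realType} {d : Order.disp_t} {Delta : directedType d}.
Variable H : locHilbertType R Delta.
Implicit Types (x y z : H) (alpha beta : Delta).

Lemma lhnorm_ge0 x : 0 <= lhnorm x.
Proof. exact: sqrtr_ge0. Qed.

Lemma lhnormD x y : lhnorm (x + y) <= lhnorm x + lhnorm y.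
Proof. exact: dot_normD. Qed.

Lemma lhnormN x : lhnorm (- x) = lhnorm x.
Proof. by rewrite -scaleN1r /lhnorm dot_normZ normrN normr1 mul1r. Qed.

Lemma lhnorm_sqr x : lhnorm x ^+ 2 = complex.Re (lhdot x x).
Proof. by rewrite dotxxE. Qed.

Lemma lhnorm_seminorm : seminorm (@lhnorm _ _ _ H).
Proof.
split=> [|c x]; first exact: lhnormD.
by rewrite /lhnorm dot_normZ normc_def /= -rmorphM.
Qed.

(** By the reverse triangle inequality. Hence density for the inductive limit topology implies
    density in norm. *)
Lemma lhnorm_ind_seminorm : ind_seminorm (@lhnorm _ _ _ H).
Proof.
split; first exact: lhnorm_seminorm.
move=> alpha x _ U /nbhs_ballP[e /= e0 eU].
exists tt, e => // y xy _; apply: eU; rewrite /sball /= in xy *.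
have h1 := lhnormD (y - x) x; have h2 := lhnormD (x - y) y.
rewrite !subrK in h1 h2; rewrite -opprB lhnormN in h2.
by rewrite /ball /= ltr_norml; apply/andP; split; lra.
Qed.

Lemma closed_span_dense (S : set H) x (e : R) :
  closed_span S = setT -> 0 < e -> exists2 w, lspan S w & lhnorm (w - x) < e.
Proof.
move=> ST e0; have : closed_span S x by rewrite ST.
case/(_ [set w | lhnorm (w - x) < e]).
  by exists (exist _ _ lhnorm_ind_seminorm), e.
by move=> w [Sw xw]; exists w.
Qed.

(** If [w] in the span approximates [y], then [w] is orthogonal to [y], so the square of the norm of
    [y] is the real part of [lhdot (y - w) y], which Cauchy-Schwarz makes small. *)
Lemma closed_span_total (S : set H) y :
  closed_span S = setT -> (forall s, S s -> lhdot s y = 0) -> y = 0.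
Proof.
move=> ST Sy; apply: (dot_norm_eq0 (dot := lhdot)); rewrite -/(lhnorm y).
apply/eqP; rewrite eq_le lhnorm_ge0 andbT; apply/ler_addgt0Pr => e e0.
have [w [m [c [v [Sv wE]]]] yw] := closed_span_dense y ST e0.
rewrite add0r; have [->|n0] := eqVneq (lhnorm y) 0; first exact: ltW.
have np : 0 < lhnorm y by rewrite lt_def n0 lhnorm_ge0.
have wy : lhdot w y = 0.
  by rewrite wE linear_sumlz big1 // => j _; rewrite linearZl_LR /= Sy ?mulr0.
rewrite -(ler_pM2r np) -expr2 lhnorm_sqr.
have -> : lhdot y y = lhdot (y - w) y by rewrite linearBl /= wy subr0.
apply: le_trans (ler_norm _) (le_trans (Re_dot_le _ _ _) _).
by rewrite -/(lhnorm _) -/(lhnorm _) -opprB lhnormN ler_wpM2r ?lhnorm_ge0 ?ltW.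
Qed.

Lemma total_dot_inj (I : Type) (u : I -> H) x y :
  closed_span (range u) = setT ->
  (forall i, lhdot (u i) x = lhdot (u i) y) -> x = y.
Proof.
move=> uT xy; apply/eqP; rewrite -subr_eq0; apply/eqP.
by apply: (closed_span_total uT) => _ [i _ <-]; rewrite linearBr /= xy subrr.
Qed.

Lemma lhproj_linear alpha : linear (@lhproj _ _ _ H alpha).
Proof.
move=> c x y; have [px ox] := lhprojP alpha x; have [py oy] := lhprojP alpha y.
apply: lhprojE; first exact: lhsubP.
move=> z za; rewrite opprD addrACA -scalerBr linearDl linearZl_LR /=.
by rewrite ox // oy // mulr0 addr0.
Qed.

HB.instance Definition _ alpha :=
  GRing.isLinear.Build R[i] H H *:%R (@lhproj _ _ _ H alpha)
    (lhproj_linear alpha).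

Lemma lhproj_id alpha x : lhsub alpha x -> lhproj alpha x = x.
Proof. by move=> xa; apply: lhprojE => // z _; rewrite subrr linear0l. Qed.

Lemma lhproj_selfadjoint alpha x y :
  lhdot (lhproj alpha x) y = lhdot x (lhproj alpha y).
Proof.
have [px ox] := lhprojP alpha x; have [py oy] := lhprojP alpha y.
have /eqP := ox _ py; rewrite linearBl subr_eq0 => /eqP ->.
rewrite lhdotC [RHS]lhdotC; congr (_^*).
by have /eqP := oy _ px; rewrite linearBl subr_eq0 => /eqP.
Qed.

Lemma lhproj_le alpha x : lhnorm (lhproj alpha x) <= lhnorm x.
Proof.
have [->|n0] := eqVneq (lhnorm (lhproj alpha x)) 0; first exact: lhnorm_ge0.
have np : 0 < lhnorm (lhproj alpha x) by rewrite lt_def n0 lhnorm_ge0.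
rewrite -(ler_pM2r np) -expr2 lhnorm_sqr lhproj_selfadjoint.
rewrite (lhproj_id (lhprojP alpha x).1).
exact: le_trans (ler_norm _) (Re_dot_le _ _ _).
Qed.

(** Passing to adjoints turns agreement on [S] into orthogonality: [adj T y - adj U y] is orthogonal
    to [S] for every [y]. *)
Lemma lhop_eq_total (L : locHilbertType R Delta) (S : set H) (T U : lhop H L) :
  closed_span S = setT -> (forall s, S s -> T s = U s) -> T = U.
Proof.
move=> ST TU; rewrite -[T]adjK -[U]adjK; congr adj; apply: lhop_eq => y.
apply/eqP; rewrite -subr_eq0; apply/eqP; apply: (closed_span_total ST) => s Ss.
by rewrite linearBr /= -!adjP TU // subrr.
Qed.

End Density.

(** * Transporting a vector between two families with the same Gram matrix *)

Section GramTransport.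
Context {R : realType} {d : Order.disp_t} {Delta : directedType d}.
Context {H H' : locHilbertType R Delta} {I : Type}.
Variables (v : I -> H) (v' : I -> H') (q : Delta -> I -> I).
Hypothesis gram : forall i j, lhdot (v i) (v j) = lhdot (v' i) (v' j).
Hypothesis vq : forall alpha i, lhproj alpha (v i) = v (q alpha i).
Hypothesis vq' : forall alpha i, lhproj alpha (v' i) = v' (q alpha i).
Hypothesis v_total : closed_span (range v) = setT.

Let comb {V : lmodType R[i]} (u : I -> V) m (c : 'I_m -> R[i]) (k : 'I_m -> I) :=
  \sum_j c j *: u (k j).

Let dot_comb m (c : 'I_m -> R[i]) k m' (c' : 'I_m' -> R[i]) k' :
  lhdot (comb v c k) (comb v c' k') = lhdot (comb v' c k) (comb v' c' k').
Proof.
rewrite /comb !linear_sumlz; apply: eq_bigr => i _.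
rewrite !linear_sumr; apply: eq_bigr => j _.
by rewrite !linearZl_LR !linearZr_LR /= gram.
Qed.

Let norm_comb m (c : 'I_m -> R[i]) k :
  lhnorm (comb v' c k) = lhnorm (comb v c k).
Proof. by rewrite /lhnorm /dot_norm dot_comb. Qed.

Let norm_combB m (c : 'I_m -> R[i]) k m' (c' : 'I_m' -> R[i]) k' :
  lhnorm (comb v' c k - comb v' c' k') = lhnorm (comb v c k - comb v c' k').
Proof.
by rewrite /lhnorm /dot_norm !(linearBl, linearBr) /= -!dot_comb.
Qed.

(** The projection onto [lhsub alpha] fixes [x] and does not increase norms, so projecting an
    approximant keeps it as close to [x]. *)
Let comb_dense alpha x (e : R) : lhsub alpha x -> 0 < e ->
  exists m (c : 'I_m -> R[i]) k, lhnorm (comb v c (q alpha \o k) - x) < e.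
Proof.
move=> xa e0.
have [w [m [c [u [vu ->]]]] wx] := closed_span_dense x v_total e0.
have /choice[k ku] : forall j, exists i, v i = u j.
  by move=> j; have [i _ <-] := vu j; exists i.
exists m, c, k; apply: le_lt_trans wx.
rewrite -[x in X in X <= _](lhproj_id xa).
have -> : comb v c (q alpha \o k) = lhproj alpha (\sum_j c j *: u j).
  rewrite linear_sum; apply: eq_bigr => j _.
  by rewrite linearZ /= -vq ku.
by rewrite -linearB lhproj_le.
Qed.

(* [x'] is the limit of the images of the combinations of the [v i] that
   approximate [x]; replacing [v i] by its projection [v (q alpha i)] keeps
   these images inside the complete space [lhsub alpha]. *)
Lemma gram_transport alpha x : lhsub alpha x -> exists x',
  [/\ lhsub alpha x', lhnorm x' <= lhnorm x &
      forall i, lhdot (v i) x = lhdot (v' i) x'].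
Proof.
move=> xa.
pose F : set_system H' := [set U | exists2 e, 0 < e & forall m (c : 'I_m -> R[i]) k,
  lhnorm (comb v c (q alpha \o k) - x) < e -> U (comb v' c (q alpha \o k))].
have F_proper : ProperFilter F.
  split.
    case=> e e0 e_empty; have [m [c [k xk]]] := comb_dense xa e0.
    exact: e_empty xk.
  split.
  - by exists 1.
  - move=> U V [e e0 eU] [e' e'0 e'V]; exists (Num.min e e').
      by rewrite lt_min e0.
    by move=> m c k; rewrite lt_min => /andP[/eU ? /e'V ?].
  - by move=> U V UV [e e0 eU]; exists e => // m c k /eU /UV.
have Fa : F (lhsub alpha).
  exists 1 => // m c k _; rewrite /comb.
  apply: (big_ind (lhsub alpha)) => [|y z ya za|j _]; first exact: lhsub0.
    by rewrite -[y]scale1r; apply: lhsubP.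
  rewrite -[_ *: _]addr0 -vq'; apply: lhsubP; last exact: lhsub0.
  by case: (lhprojP alpha (v' (k j))).
(* Two combinations within [e / 2] of [x] are within [e] of each other, and [norm_combB] carries
   this distance over to their images. *)
have F_cauchy : scauchy (fun _ : unit => dot_norm lhdot) F.
  move=> t e e0; have e20 : 0 < e / 2 by rewrite divr_gt0.
  have [m [c [k xk]]] := comb_dense xa e20.
  exists (comb v' c (q alpha \o k)), (e / 2) => // m' c' k' xk'.
  rewrite /sball /= -/(lhnorm _) norm_combB.
  have := lhnormD (comb v c' (q alpha \o k') - x) (x - comb v c (q alpha \o k)).
  rewrite addrA subrK -(opprB _ x) lhnormN; lra.
have [x' x'a Fx'] := @lhsub_complete _ _ _ H' alpha F F_proper Fa F_cauchy.
have approx e : 0 < e -> exists m (c : 'I_m -> R[i]) k,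
    lhnorm (comb v c k - x) < e /\ lhnorm (comb v' c k - x') < e.
  move=> e0; have Fe : F [set y | lhnorm (y - x') < e] by apply: Fx'; exists tt, e.
  have Fc : F [set y | exists m (c : 'I_m -> R[i]) k,
      lhnorm (comb v c k - x) < e /\ y = comb v' c k].
    by exists e => // m c k xk; exists m, c, (q alpha \o k).
  have [_ [[m [c [k [xk ->]]]] x'k]] :=
    @filter_ex _ F F_proper _ (@filterI _ F (@filter_filter _ _ F_proper) _ _ Fc Fe).
  by exists m, c, k.
(* The Cauchy-Schwarz bound at hand concerns real parts only; the free scalar [a] serves to recover
   the imaginary part afterwards. *)
have dot_Re (a : R[i]) i :
    complex.Re (lhdot (a *: v i) x) = complex.Re (lhdot (a *: v' i) x').
  set b := complex.Re _; set b' := complex.Re _.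
  (* The two approximation errors add up to at most [C * (e / C)]; the summand 1 keeps [C]
     positive. *)
  pose C := lhnorm (a *: v i) + lhnorm (a *: v' i) + 1.
  have C0 : 0 < C.
    by rewrite /C; have := lhnorm_ge0 (a *: v i); have := lhnorm_ge0 (a *: v' i); lra.
  apply/eqP; rewrite -subr_eq0 -normr_le0; apply/ler_addgt0Pr => e e0.
  have eC : 0 < e / C by rewrite divr_gt0.
  have [m [c [k [xk x'k]]]] := approx _ eC.
  pose g := complex.Re (lhdot (a *: v i) (comb v c k)).
  have gE : g = complex.Re (lhdot (a *: v' i) (comb v' c k)).
    rewrite /g !linearZl_LR /comb !linear_sumr; congr (complex.Re (_ * _)).
    by apply: eq_bigr => j _; rewrite !linearZr_LR /= gram.
  have h : `|g - b| <= lhnorm (a *: v i) * (e / C).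
    have -> : g - b = complex.Re (lhdot (a *: v i) (comb v c k - x)).
      by rewrite linearBr raddfB.
    apply: le_trans (Re_dot_le _ _ _) _.
    by rewrite ler_wpM2l ?lhnorm_ge0 // ltW.
  have h' : `|g - b'| <= lhnorm (a *: v' i) * (e / C).
    have -> : g - b' = complex.Re (lhdot (a *: v' i) (comb v' c k - x')).
      by rewrite linearBr raddfB gE.
    apply: le_trans (Re_dot_le _ _ _) _.
    by rewrite ler_wpM2l ?lhnorm_ge0 // ltW.
  have -> : b - b' = (g - b') - (g - b) by ring.
  apply: le_trans (ler_normB _ _) _.
  have eE : C * (e / C) = e by rewrite mulrC divfK // gt_eqF.
  rewrite add0r -[X in _ <= X]eE {1}/C !mulrDl mul1r; lra.
exists x'; split=> // [|i].
  apply/ler_addgt0Pr => e e0; have e20 : 0 < e / 2 by rewrite divr_gt0.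
  have [m [c [k [xk x'k]]]] := approx _ e20.
  have h := lhnormD (comb v c k - x) x.
  have h' := lhnormD (x' - comb v' c k) (comb v' c k).
  rewrite subrK in h; rewrite subrK -opprB lhnormN norm_comb in h'; lra.
(* The scalar 1 compares the real parts, the scalar ['i] the imaginary parts. *)
have := dot_Re 1 i; have := dot_Re 'i%C i.
rewrite !linearZl_LR /= !mul1r.
case: (lhdot (v i) x) (lhdot (v' i) x') => r s [r' s'] /=.
by rewrite !mul0r !mul1r !sub0r => /oppr_inj -> ->.
Qed.

End GramTransport.

(** * The unitary operator induced by equal Gram matrices *)

Section GramUnitary.
Context {R : realType} {d : Order.disp_t} {Delta : directedType d}.
Context {H H' : locHilbertType R Delta} {I : Type}.
Variables (v : I -> H) (v' : I -> H') (q : Delta -> I -> I).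
Hypothesis gram : forall i j, lhdot (v i) (v j) = lhdot (v' i) (v' j).
Hypothesis vq : forall alpha i, lhproj alpha (v i) = v (q alpha i).
Hypothesis vq' : forall alpha i, lhproj alpha (v' i) = v' (q alpha i).
Hypothesis v_total : closed_span (range v) = setT.
Hypothesis v'_total : closed_span (range v') = setT.

Lemma gram_lhop : exists U : lhop H H',
  forall x i, lhdot (v i) x = lhdot (v' i) (U x).
Proof.
have /choice[U UE] : forall x, exists x', forall i, lhdot (v i) x = lhdot (v' i) x'.
  move=> x; have [alpha xa] := @lhsub_cover _ _ _ H x.
  have [x' [_ _ xx']] := gram_transport gram vq vq' v_total xa.
  by exists x'.
have U_uniq x x' : (forall i, lhdot (v i) x = lhdot (v' i) x') -> U x = x'.
  by move=> xx'; apply: (total_dot_inj v'_total) => i; rewrite -UE xx'.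
(* [U x] was chosen using one index, but by uniqueness it is also the vector transported at any
   [alpha] with [x] in [lhsub alpha]. *)
have U_bound alpha x : lhsub alpha x -> lhsub alpha (U x) /\ lhnorm (U x) <= lhnorm x.
  move=> xa; have [x' [x'a x'x xx']] := gram_transport gram vq vq' v_total xa.
  by rewrite (U_uniq _ _ xx').
have UP : is_lhop U.
  split=> [c x y|alpha x /U_bound[]|alpha|alpha beta ab x xb] //.
  - by apply: U_uniq => i; rewrite !linearPr /= !UE.
  - by exists 1 => x /U_bound[_]; rewrite mul1r.
  (* Self-adjointness moves the projection onto [v i] and [v' i], where it acts on indices by the
     same [q alpha]. *)
  - apply/esym/U_uniq => i.
    by rewrite -!lhproj_selfadjoint vq vq' UE.
by exists (mklhop UP).
Qed.

End GramUnitary.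

(** Transport from [H] to [H'] and transport back are mutually inverse, as both preserve the inner
    products with the total families. *)
Lemma gram_unitary (R : realType) (d : Order.disp_t) (Delta : directedType d)
    (H H' : locHilbertType R Delta) (I : Type)
    (v : I -> H) (v' : I -> H') (q : Delta -> I -> I) :
  (forall i j, lhdot (v i) (v j) = lhdot (v' i) (v' j)) ->
  (forall alpha i, lhproj alpha (v i) = v (q alpha i)) ->
  (forall alpha i, lhproj alpha (v' i) = v' (q alpha i)) ->
  closed_span (range v) = setT -> closed_span (range v') = setT ->
  exists2 U : lhop H H', unitary U & forall i, U (v i) = v' i.
Proof.
move=> gram vq vq' vT v'T.
have [U UE] := gram_lhop gram vq vq' vT v'T.
have [V VE] := gram_lhop (fun i j => esym (gram i j)) vq' vq v'T vT.
have Uv i : U (v i) = v' i.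
  by apply: (total_dot_inj v'T) => j; rewrite -UE gram.
(* Transport is characterised by inner products against a total family, so the
   adjoint of [U] is the transport in the other direction. *)
have adjU : adj U = V.
  apply: lhop_eq => y; apply: (total_dot_inj vT) => i.
  by rewrite -adjP Uv VE.
exists U => //; rewrite /unitary adjU; split; apply: lhop_eq => x /=.
  by apply: (total_dot_inj vT) => i; rewrite -VE -UE.
by apply: (total_dot_inj v'T) => i; rewrite -UE -VE.
Qed.

(** * The two total families of a minimal Stinespring representation *)

Section MinimalStinespring.
Context {R : realType} {d : Order.disp_t} {Delta : directedType d}.
Context {A : locCstarType R Delta} {M : hilbertModType A}.
Context {n : nat} {calH calK : locHilbertType R Delta}.
Variable phi : 'I_n -> 'I_n -> {linear A -> lhop calH calH}.
Variable Phi : 'I_n -> 'I_n -> {linear M -> lhop calH calK}.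
Context {H K : locHilbertType R Delta}.
Variables (piA : {linear A -> lhop H H}) (pi : {linear M -> lhop H K}).
Variables (S : 'I_n -> lhop calH H) (W : 'I_n -> lhop calK K).

(** Generic in [rho], so that [piA] (with values in [H]) and [pi] (with values in [K]) are treated
    together. *)
Definition orbit_vec (B : Type) (L : locHilbertType R Delta) (rho : B -> lhop H L)
  (t : 'I_n * B * calH) : L := rho t.1.2 (S t.1.1 t.2).

(** The index map [q] of the transport: operators commute with projections, so only the vector in
    [calH] gets projected. *)
Definition orbit_proj (B : Type) (alpha : Delta) (t : 'I_n * B * calH) :=
  (t.1, lhproj alpha t.2).

Lemma lhproj_orbit_vec (B : Type) (L : locHilbertType R Delta) (rho : B -> lhop H L)
  alpha t : lhproj alpha (orbit_vec rho t) = orbit_vec rho (orbit_proj alpha t).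
Proof. by rewrite /orbit_vec !lhop_proj. Qed.

Lemma range_orbit_vec (B : Type) (L : locHilbertType R Delta) (rho : B -> lhop H L) :
  range (orbit_vec rho) = \bigcup_i [set z | exists b h, z = rho b (S i h)].
Proof.
apply/seteqP; split=> [_ [[[i b] h] _ <-]|_ [i _ [b [h ->]]]].
  by exists i => //; exists b, h.
by exists (i, b, h).
Qed.

Hypothesis minS : minimal_stinespring_representation phi Phi piA pi S W.

Lemma orbit_algebra_total : closed_span (range (orbit_vec piA)) = setT.
Proof. by rewrite range_orbit_vec; case: minS. Qed.

Lemma orbit_module_total : closed_span (range (orbit_vec pi)) = setT.
Proof. by rewrite range_orbit_vec; case: minS. Qed.

(** The right-hand side involves [phi] alone, so it is the same for every minimal representation. *)
Lemma gram_algebra s t : lhdot (orbit_vec piA s) (orbit_vec piA t) =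
  lhdot s.2 (phi s.1.1 t.1.1 (star s.1.2 * t.1.2) t.2).
Proof.
case: minS => -[[_ _ [piM piV] _] phiE _] _ _.
by rewrite /orbit_vec phiE piM piV /= -!adjP.
Qed.

Lemma gram_module s t : lhdot (orbit_vec pi s) (orbit_vec pi t) =
  lhdot s.2 (phi s.1.1 t.1.1 (hmdot s.1.2 t.1.2) t.2).
Proof.
case: minS => -[[_ _ _ piE] phiE _] _ _.
by rewrite /orbit_vec phiE -piE /= -!adjP.
Qed.

(** A [star_morphism] may fail to preserve 1; minimality forces it, since [piA 1] fixes every
    [piA a (S i h)]. *)
Lemma stinespring1 x : piA 1 x = x.
Proof.
case: minS => -[[_ _ [piM _] _] _ _] _ _.
suff -> : piA 1 = lhop_id H by [].
apply: (lhop_eq_total orbit_algebra_total) => _ [t _ <-].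
by rewrite -[LHS]/((piA 1 * piA t.1.2) (S t.1.1 t.2)) -piM mul1r.
Qed.

(** Tested against a vector [pi y (S j k)], both sides reduce to [piA (hmdot y x * a)]. *)
Lemma stinespring_ract x a h : pi (ract x a) h = pi x (piA a h).
Proof.
case: minS => -[[_ _ [piM _] piE] _ _] _ _.
apply: (total_dot_inj orbit_module_total) => t.
rewrite /orbit_vec !(adjP (pi _)).
rewrite -[adj _ _]/((adj (pi t.1.2) \oL pi (ract x a)) h).
rewrite -[adj _ (pi x _)]/((adj (pi t.1.2) \oL pi x) (piA a h)).
by rewrite !piE hmdotAr piM.
Qed.

End MinimalStinespring.

(** * The two unitaries and their intertwining relations *)

Theorem theorem2p4 (R : realType) (d : Order.disp_t) (Delta : directedType d)
    (A : locCstarType R Delta) (M : hilbertModType A)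
    (calH calK : locHilbertType R Delta) (n : nat)
    (phi : 'I_n -> 'I_n -> {linear A -> lhop calH calH})
    (Phi : 'I_n -> 'I_n -> {linear M -> lhop calH calK})
    (phi_cnp : continuous_completely_n_positive phi)
    (Phi_cp : phi_completely_positive phi Phi)
    (H K : locHilbertType R Delta)
    (piA : {linear A -> lhop H H}) (pi : {linear M -> lhop H K})
    (S : 'I_n -> lhop calH H) (W : 'I_n -> lhop calK K)
    (minS : minimal_stinespring_representation phi Phi piA pi S W)
    (H' K' : locHilbertType R Delta)
    (piA' : {linear A -> lhop H' H'}) (pi' : {linear M -> lhop H' K'})
    (S' : 'I_n -> lhop calH H') (W' : 'I_n -> lhop calK K')
    (minS' : minimal_stinespring_representation phi Phi piA' pi' S' W') :
  exists (U1 : lhop H H') (U2 : lhop K K'),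
    [/\ unitary U1, unitary U2,
        (forall i, U1 \oL S i = S' i) /\
          (forall a, U1 \oL piA a = piA' a \oL U1) &
        (forall i, U2 \oL W i = W' i) /\
          (forall x, U2 \oL pi x = pi' x \oL U1)].
Proof.
have [U1 U1u U1E] := gram_unitary
  (fun s t => etrans (gram_algebra minS s t) (esym (gram_algebra minS' s t)))
  (lhproj_orbit_vec S piA) (lhproj_orbit_vec S' piA')
  (orbit_algebra_total minS) (orbit_algebra_total minS').
have [U2 U2u U2E] := gram_unitary
  (fun s t => etrans (gram_module minS s t) (esym (gram_module minS' s t)))
  (lhproj_orbit_vec S pi) (lhproj_orbit_vec S' pi')
  (orbit_module_total minS) (orbit_module_total minS').
have U1S i a h : U1 (piA a (S i h)) = piA' a (S' i h) := U1E (i, a, h).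
have U2S i x h : U2 (pi x (S i h)) = pi' x (S' i h) := U2E (i, x, h).
have [[[_ _ [piM _] _] _ PhiE] _ _] := minS.
have [[[_ _ [piM' _] _] _ PhiE'] _ _] := minS'.
exists U1, U2; split=> //; split.
- move=> i; apply: lhop_eq => h /=.
  (* Writing [S i h] as [piA 1 (S i h)] places it in the family on which [U1] is known. *)
  by rewrite -[S i h](stinespring1 minS) U1S (stinespring1 minS').
- move=> a; apply: (lhop_eq_total (orbit_algebra_total minS)) => _ [[[i b] h] _ <-].
  rewrite /orbit_vec /= U1S -[piA a _]/((piA a * piA b) (S i h)) -piM U1S.
  by rewrite piM'.
(* [Phi] determines [adj (W i)] on the total family [pi x (S j h)], so the adjoints are compared
   first; unitarity of [U2] then gives the claim. *)
- move=> i; have WE : adj (W i) = adj (W' i) \oL U2.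
    apply: (lhop_eq_total (orbit_module_total minS)) => _ [[[j x] h] _ <-].
    rewrite /orbit_vec /= U2S -[LHS]/((adj (W i) \oL pi x \oL S j) h) -PhiE.
    by rewrite PhiE'.
  have -> : W i = adj U2 \oL W' i by rewrite -[W i]adjK WE adj_comp adjK.
  apply: lhop_eq => k.
  by rewrite -[LHS]/((U2 \oL adj U2) (W' i k)) U2u.2.
(* On the total family, [pi x (piA a (S i h))] equals [pi (ract x a) (S i h)], a vector whose image
   under [U2] is known. *)
- move=> x; apply: (lhop_eq_total (orbit_algebra_total minS)) => _ [[[i a] h] _ <-].
  rewrite /orbit_vec /= U1S -(stinespring_ract minS) U2S.
  exact: (stinespring_ract minS').
Qed.
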